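(* Consider a network with true network matrix $G^0(q)$ on a directed graph with node set $V=\{1,\dots,L\}$, and let $G$ be any matrix consistent with the graph such that $I-G$ is invertible (in particular $G=G^0$). Put $T=(I-G)^{-1}$. 1) If node $i$ is a source, then $G_{ij}=0$ for all $j$, $T_{ii}=1$ and $T_{ij}=0$ for all $j\neq i$. Consequently the $L$ scalar equations contributed by a measurement of node $i$ to the system $CT^0(I-G)=C$ hold trivially for every $G$ consistent with the graph, so that measuring a source is useless: adding $i$ to, or removing $i$ from, the set of measured nodes does not change which transfer functions can be identified. On the other hand each source requires excitation: if a source $i$ is not excited, then the network is not identifiable, whatever the set of measured nodes. 2) If node $i$ is a sink, then $G_{ji}=0$ for all $j$, $T_{ii}=1$ and $T_{ji}=0$ for all $j\neq i$. Identifiability of the network requires that all sinks be measured: if some sink is not measured, the network is not identifiable. But exciting a sink is useless: adding a sink $i$ to, or removing it from, the set of excited nodes does not change which transfer functions can be identified.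
   Context: Network: a directed graph without self-loops on $V=\{1,\dots,L\}$, whose topology is known, together with an $L\times L$ matrix $G^0(q)$ of proper real rational transfer functions. The entry $G^0_{ij}$ is the transfer function of the edge from node $j$ to node $i$; $G^0_{ij}\neq 0$ if and only if there is an edge from $j$ to $i$; $G^0_{ii}=0$. There is a delay in every cycle and $I-G^0$ is invertible with $(I-G^0)^{-1}$ proper and stable; $T^0=(I-G^0)^{-1}$. The node signals satisfy $w=G^0w+r$, $y=Cw$, where $r_i$ is a known external excitation at node $i$ (sufficiently rich, mutually uncorrelated), and $C$ is the $p\times L$ selection matrix ($0/1$, one $1$ per row) of the set $\mathcal C\subseteq V$ of $p$ measured nodes. A matrix $G$ of proper rational transfer functions is consistent with the graph if $G_{ij}=0$ whenever there is no edge from $j$ to $i$. If all nodes are excited, $CT^0$ is known exactly and the unknown transfer functions are to be recovered from $CT^0(I-G)=C$. More generally, if only the nodes of a set $R\subseteq V$ are excited, the available data are the submatrix of $T^0$ with rows in $\mathcal C$ and columns in $R$. The transfer function of an edge from $j$ to $k$ can be identified if $G_{kj}=G^0_{kj}$ for every $G$ consistent with the graph such that $I-G$ is invertible and $(I-G)^{-1}$ has the same submatrix (rows $\mathcal C$, columns $R$) as $T^0$; for $R=V$ this amounts to $CT^0(I-G)=C$. The network is identifiable if the transfer functions of all its edges can be identified. Unless excitation is explicitly discussed, $R=V$. A source is a node with only outgoing edges (at least one outgoing, no incoming edge); a sink is a node with only incoming edges (at least one incoming, no outgoing edge). *)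

(* Defs.v *)
From HB Require Import structures.
From mathcomp Require Import all_boot all_order all_algebra.
From mathcomp Require Import reals.
From mathcomp Require Import complex.

Set Implicit Arguments.
Unset Strict Implicit.
Unset Printing Implicit Defensive.

Import Order.TTheory GRing.Theory Num.Theory.
Local Open Scope ring_scope.

Notation ratfun R := {fraction {poly R}}.

Section TransferFunctions.
Variable R : realType.
Implicit Types (f : ratfun R) (n d : {poly R}).

Definition lowest_terms f n d : Prop :=
  [/\ d != 0, coprimep n d & f = tofrac n / tofrac d].

(* The indeterminate is the forward shift q, so properness (causality) compares
   degrees in q; recall that size is degree + 1 and size 0 = 0. *)
Definition proper_tf f : Prop :=
  exists n d, lowest_terms f n d /\ (size n <= size d)%N.

(* f contains a delay *)
Definition strictly_proper_tf f : Prop :=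
  exists n d, lowest_terms f n d /\ (size n < size d)%N.

(* Discrete-time stability: every complex pole lies in the open unit disc. *)
Definition stable_tf f : Prop :=
  exists n d, lowest_terms f n d /\
    forall z : R[i], root (map_poly (real_complex R) d) z -> `|z| < 1.

End TransferFunctions.

Section Networks.
Variables (R : realType) (L : nat).
Implicit Types (e : rel 'I_L) (G : 'M[ratfun R]_L) (C E : {set 'I_L}).

(* e j i means that there is an edge from j to i; its transfer function is the
   entry G i j, with the indices in the opposite order. *)
Record network e G : Prop := Network {
  network_loopless : irreflexive e;
  network_proper : forall i j, proper_tf (G i j);
  network_edge : forall i j, G i j != 0 <-> e j i;
  network_delay : forall c : seq 'I_L, c != [::] -> ucycle e c ->
    exists2 j, j \in c & strictly_proper_tf (G (next c j) j);
  network_unit : 1%:M - G \in unitmx;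
  network_inv_proper : forall i j, proper_tf (invmx (1%:M - G) i j);
  network_inv_stable : forall i j, stable_tf (invmx (1%:M - G) i j) }.

Definition consistent e G : Prop :=
  (forall i j, proper_tf (G i j)) /\ (forall i j, ~~ e j i -> G i j = 0).

Definition source e (i : 'I_L) : Prop :=
  (exists j, e i j) /\ (forall j, ~~ e j i).

Definition sink e (i : 'I_L) : Prop :=
  (exists j, e j i) /\ (forall j, ~~ e i j).

(* Rows are indexed by 'I_#|C|, through the enumeration enum_val of C. *)
Definition selection_mx C : 'M[ratfun R]_(#|C|, L) :=
  \matrix_(k, j) (enum_val k == j)%:R.

Definition submatrix C E G : 'M[ratfun R]_(#|C|, #|E|) :=
  mxsub (fun k : 'I_#|C| => enum_val k) (fun l : 'I_#|E| => enum_val l) G.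

(* The transfer function of the edge from j to k can be identified in the
   network (e, G0) when the nodes of C are measured and those of E excited. *)
Definition tf_identifiable e G0 C E (j k : 'I_L) : Prop :=
  forall G, consistent e G -> 1%:M - G \in unitmx ->
    submatrix C E (invmx (1%:M - G)) = submatrix C E (invmx (1%:M - G0)) ->
    G k j = G0 k j.

Definition network_identifiable e G0 C E : Prop :=
  forall j k, e j k -> tf_identifiable e G0 C E j k.

End Networks.

Arguments selection_mx R {L} C.

(* Main.v *)
Require Import Defs.
From HB Require Import structures.
From mathcomp Require Import all_boot all_order all_algebra.
From mathcomp Require Import reals.

Set Implicit Arguments.
Unset Strict Implicit.
Unset Printing Implicit Defensive.

Import Order.TTheory GRing.Theory Num.Theory.
Local Open Scope ring_scope.

(** Everything rests on the row of the transfer matrix at a source.  If row [i]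
    of [G] vanishes, then [e_i (1 - G) = e_i], whence [e_i T = e_i] for
    [T = (1 - G)^-1] ([row_inv_row0]).  So row [i] of [T] is the same for
    every consistent [G]: a measurement of a source compares constants.

    For the necessity of excitation, the column of [G0] at the source [i] can
    be erased without disturbing the other columns of [T0].  Indeed no signal
    excited at another node ever passes through [i], so the edges leaving [i]
    only contribute to column [i] of [T0], which is not observed when [i] is not
    excited ([erase_col_inv]).  Erasing changes the network because a source has
    at least one outgoing edge, whose transfer function is nonzero.

    The statements on sinks are those on sources in the transposed network:
    reversing the edges transposes [G] and [T], exchanges sources with sinks,
    and exchanges measured with excited nodes ([tf_identifiable_tr]). *)

(** * Inverses of matrices with a zero row *)

Section ZeroRow.
Variables (F : comUnitRingType) (L : nat) (i : 'I_L).
Implicit Types G T : 'M[F]_L.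

Lemma row_sub_row0 G : row i G = 0 -> row i (1%:M - G) = row i 1%:M.
Proof. by move=> Gi0; rewrite raddfB /= Gi0 subr0. Qed.

Lemma row_inv_row0 G : row i G = 0 -> 1%:M - G \in unitmx ->
  row i (invmx (1%:M - G)) = row i 1%:M.
Proof.
move=> Gi0 uG; rewrite -[in RHS](mulmxV uG).
by rewrite row_mul row_sub_row0 // -row_mul mul1mx.
Qed.

Lemma delta_mul_row0 G : row i G = 0 -> delta_mx i i *m G = 0.
Proof.
move=> Gi0.
by rewrite -(mul_delta_mx (ord0 : 'I_1)) -mulmxA -rowE Gi0 mulmx0.
Qed.

Definition erase_col G : 'M[F]_L := G - G *m delta_mx i i.

Lemma erase_colE G a b : erase_col G a b = if b == i then 0 else G a b.
Proof.
rewrite !mxE (bigD1 i) //= big1 ?addr0 => [|c /negPf ci]; last first.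
  by rewrite mxE ci mulr0.
rewrite mxE eqxx; case: eqP => [->|_] /=; first by rewrite mulr1 subrr.
by rewrite mulr0 subr0.
Qed.

(** The new inverse is [T] with column [i] replaced by that of the identity
    matrix: the other columns of [T] vanish in row [i], hence they do not
    see column [i] of [G]. *)
Lemma erase_col_inv G : row i G = 0 -> 1%:M - G \in unitmx ->
  let T := invmx (1%:M - G) in
  1%:M - erase_col G \in unitmx
  /\ forall a b, b != i -> invmx (1%:M - erase_col G) a b = T a b.
Proof.
move=> Gi0 uG T; pose D : 'M[F]_L := delta_mx i i.
have GT : (1%:M - G) *m T = 1%:M by exact: mulmxV.
have DT : D *m T = D.
  have DG : D *m (1%:M - G) = D by rewrite mulmxBr mulmx1 delta_mul_row0 ?subr0.
  by rewrite -[in LHS]DG -mulmxA GT mulmx1.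
have DD : D *m D = D by rewrite mul_delta_mx.
have inv : (1%:M - erase_col G) *m (erase_col T + D) = 1%:M.
  have eG : 1%:M - erase_col G = 1%:M - G + G *m D.
    by rewrite /erase_col opprB addrA addrAC.
  have eGT : (1%:M - erase_col G) *m T = 1%:M + G *m D.
    by rewrite eG mulmxDl GT -mulmxA DT.
  have eGD : (1%:M - erase_col G) *m D = D.
    by rewrite eG mulmxDl -mulmxA DD mulmxBl mul1mx subrK.
  rewrite {2}/erase_col -/D mulmxDr mulmxBr mulmxA eGT eGD mulmxDl mul1mx -mulmxA DD.
  by rewrite [D + _]addrC opprD addrA addrK subrK.
have [uE _] := mulmx1_unit inv; split=> //.
have -> : invmx (1%:M - erase_col G) = erase_col T + D.
  by rewrite -[RHS](mulKmx uE) inv mulmx1.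
move=> a b /negPf bi.
by rewrite mxE erase_colE bi [D _ _]mxE bi andbF addr0.
Qed.

End ZeroRow.

(** * Duality between measurement and excitation *)

Section Duality.
Variables (R : realType) (L : nat).
Implicit Types (e : rel 'I_L) (G : 'M[ratfun R]_L) (C E : {set 'I_L}).

Lemma submatrixP C E G G' :
  submatrix C E G = submatrix C E G' <->
  {in C & E, forall a b, G a b = G' a b}.
Proof.
split=> [eqGG a b aC bE|eqGG]; last first.
  by apply/matrixP=> k l; rewrite !mxE eqGG ?enum_valP.
move/matrixP/(_ (enum_rank_in aC a) (enum_rank_in bE b)): eqGG.
by rewrite !mxE !enum_rankK_in.
Qed.

Lemma trE G a b : G^T a b = G b a.
Proof. exact: mxE. Qed.

Definition reverse e : rel 'I_L := fun x y => e y x.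

Lemma consistent_tr e G : consistent e G -> consistent (reverse e) G^T.
Proof. by case=> pG zG; split=> a b; rewrite trE //; apply: zG. Qed.

Lemma trmx_sub1 G : 1%:M - G^T = (1%:M - G)^T.
Proof. by rewrite linearB /= trmx1. Qed.

Lemma unit_tr G : (1%:M - G^T \in unitmx) = (1%:M - G \in unitmx).
Proof. by rewrite trmx_sub1 unitmx_tr. Qed.

Lemma inv_tr G : invmx (1%:M - G^T) = (invmx (1%:M - G))^T.
Proof. by rewrite trmx_sub1 trmx_inv. Qed.

(** Transposition maps the candidates of one network bijectively onto those of
    the other, and it transposes the data. *)
Lemma tf_identifiable_trW e G0 C E j k :
  tf_identifiable e G0 C E j k ->
  tf_identifiable (reverse e) G0^T E C k j.
Proof.
move=> idG G cG uG /submatrixP eqT.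
have uGt : 1%:M - G^T \in unitmx by rewrite unit_tr.
rewrite -(trE G) [RHS]trE; apply: (idG _ (consistent_tr cG) uGt).
apply/submatrixP=> a b aC bE.
transitivity (invmx (1%:M - G) b a); first by rewrite [in LHS]inv_tr trE.
apply: etrans (eqT b a bE aC) _.
by rewrite [in LHS]inv_tr trE.
Qed.

Lemma tf_identifiable_tr e G0 C E j k :
  tf_identifiable e G0 C E j k <->
  tf_identifiable (reverse e) G0^T E C k j.
Proof.
split; first exact: tf_identifiable_trW.
by move/tf_identifiable_trW; rewrite trmxK.
Qed.

Lemma network_identifiable_tr e G0 C E :
  network_identifiable e G0 C E ->
  network_identifiable (reverse e) G0^T E C.
Proof. by move=> idG j k ekj; apply/tf_identifiable_trW/idG. Qed.

End Duality.

(** * Sources *)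

Section Source.
Variables (R : realType) (L : nat) (e : rel 'I_L) (i : 'I_L).
Hypothesis src : source e i.
Implicit Types (G : 'M[ratfun R]_L) (C E : {set 'I_L}).

Lemma source_row0 G : consistent e G -> row i G = 0.
Proof.
by case=> _ zG; apply/rowP=> j; rewrite !mxE zG //; case: src => _; apply.
Qed.

Lemma source_inv G : consistent e G -> 1%:M - G \in unitmx ->
  forall j, invmx (1%:M - G) i j = (i == j)%:R.
Proof.
move=> cG uG j; have := row_inv_row0 (source_row0 cG) uG.
by move/rowP/(_ j); rewrite !mxE.
Qed.

Lemma source_structure G : consistent e G -> 1%:M - G \in unitmx ->
  let T := invmx (1%:M - G) in
  [/\ forall j, G i j = 0, T i i = 1 & forall j, j != i -> T i j = 0].
Proof.
move=> cG uG T; split=> [j||j ji]; last 2 first.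
- by rewrite source_inv ?eqxx.
- by rewrite source_inv // eq_sym (negPf ji).
by have /rowP/(_ j) := source_row0 cG; rewrite !mxE.
Qed.

Variable G0 : 'M[ratfun R]_L.
Hypotheses (cG0 : consistent e G0) (uG0 : 1%:M - G0 \in unitmx).

(** With [e_i T0 = e_i], the equations of a measured source [i] read
    [e_i (1 - G) = e_i], which only says that row [i] of [G] vanishes. *)
Lemma source_equations C (k : 'I_#|C|) G : enum_val k = i ->
  consistent e G ->
  row k (selection_mx R C *m invmx (1%:M - G0) *m (1%:M - G))
    = row k (selection_mx R C).
Proof.
move=> ki cG.
have rowk : row k (selection_mx R C) = row i 1%:M.
  by apply/rowP=> j; rewrite !mxE ki.
rewrite -mulmxA row_mul rowk -row_mul mul1mx row_mul.
rewrite (row_inv_row0 (source_row0 cG0) uG0) -row_mul mul1mx.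
exact: row_sub_row0 (source_row0 cG).
Qed.

(** Since row [i] of the inverse is known beforehand, agreement of the data on
    the rows other than [i] already is agreement on all rows. *)
Lemma source_measureW C C' E j k : C :\ i \subset C' ->
  tf_identifiable e G0 C E j k -> tf_identifiable e G0 C' E j k.
Proof.
move=> sCC' idG G cG uG /submatrixP eqT; apply: (idG G cG uG).
apply/submatrixP=> a b aC bE; have [->|ai] := eqVneq a i.
  exact: etrans (source_inv cG uG b) (esym (source_inv cG0 uG0 b)).
have aC' : a \in C' by apply: (subsetP sCC'); rewrite !inE ai.
exact: eqT a b aC' bE.
Qed.

Lemma source_measure C E j k :
  (tf_identifiable e G0 (i |: C) E j k <-> tf_identifiable e G0 C E j k)
  /\ (tf_identifiable e G0 (C :\ i) E j k <-> tf_identifiable e G0 C E j k).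
Proof.
do 2!split; apply: source_measureW; apply/subsetP=> a; rewrite !inE.
- by case/andP=> /negPf ->.
- by case/andP=> _ ->; rewrite orbT.
- by case/and3P.
- by [].
Qed.

Lemma proper_tf0 : proper_tf (0 : ratfun R).
Proof.
exists 0, 1; split; last by rewrite size_poly0.
by split; rewrite ?oner_neq0 ?coprimep1 ?rmorph0 ?mul0r.
Qed.

Lemma erase_col_consistent G : consistent e G -> consistent e (erase_col i G).
Proof.
case=> pG zG; split=> a b => [|/zG Gab0]; rewrite erase_colE.
  by case: ifP => // _; exact: proper_tf0.
by rewrite Gab0 if_same.
Qed.

(** A competitor with the same data is [G0] with all edges leaving [i] removed. *)
Lemma source_excitation C E : (forall a b, e a b -> G0 b a != 0) ->
  i \notin E -> ~ network_identifiable e G0 C E.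
Proof.
move=> nzG0 iE idG; have [[k eik] _] := src.
have [uH invH] := erase_col_inv (source_row0 cG0) uG0.
have eqT : submatrix C E (invmx (1%:M - erase_col i G0))
         = submatrix C E (invmx (1%:M - G0)).
  apply/submatrixP=> a b _ bE; apply: invH.
  by apply: contraNneq iE => <-.
have := idG i k eik _ (erase_col_consistent cG0) uH eqT.
by rewrite erase_colE eqxx => G0ki; move: (nzG0 _ _ eik); rewrite -G0ki eqxx.
Qed.

End Source.

(** * Sources and sinks of a network *)

Theorem mainTheorem1 (R : realType) (L : nat) (e : rel 'I_L)
    (G0 : 'M[ratfun R]_L) (netG0 : network e G0) :
  (forall i : 'I_L, source e i ->
    [/\ forall G : 'M[ratfun R]_L, consistent e G -> 1%:M - G \in unitmx ->
          let T := invmx (1%:M - G) in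
          [/\ forall j, G i j = 0, T i i = 1 & forall j, j != i -> T i j = 0],
        forall (C : {set 'I_L}) (k : 'I_#|C|), enum_val k = i ->
          forall G : 'M[ratfun R]_L, consistent e G ->
          forall j, (selection_mx R C *m invmx (1%:M - G0) *m (1%:M - G)) k j
                    = selection_mx R C k j,
        forall (C E : {set 'I_L}) (j k : 'I_L), e j k ->
          (tf_identifiable e G0 (i |: C) E j k <-> tf_identifiable e G0 C E j k)
          /\
          (tf_identifiable e G0 (C :\ i) E j k <-> tf_identifiable e G0 C E j k)
      & forall C E : {set 'I_L}, i \notin E -> ~ network_identifiable e G0 C E])
  /\
  (forall i : 'I_L, sink e i ->
    [/\ forall G : 'M[ratfun R]_L, consistent e G -> 1%:M - G \in unitmx ->
          let T := invmx (1%:M - G) in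
          [/\ forall j, G j i = 0, T i i = 1 & forall j, j != i -> T j i = 0],
        forall C E : {set 'I_L}, i \notin C -> ~ network_identifiable e G0 C E
      & forall (C E : {set 'I_L}) (j k : 'I_L), e j k ->
          (tf_identifiable e G0 C (i |: E) j k <-> tf_identifiable e G0 C E j k)
          /\
          (tf_identifiable e G0 C (E :\ i) j k <-> tf_identifiable e G0 C E j k)]).
Proof.
have cG0 : consistent e G0.
  split=> [a b|a b nab]; first exact: network_proper netG0 a b.
  by apply/eqP; apply: contraNT nab => /(network_edge netG0 a b).
have uG0 := network_unit netG0.
have nzG0 a b : e a b -> G0 b a != 0 by move/(network_edge netG0 b a).
split=> i.
  move=> src; split.
  - exact: source_structure src.
  - move=> C k ki G cG j.
    by have /rowP/(_ j) := source_equations src cG0 uG0 ki cG; rewrite !mxE.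
  - by move=> C E j k _; exact: source_measure.
  - by move=> C E; exact: source_excitation.
(* A sink of [e] is literally a source of the reversed graph. *)
move=> snk; have src : source (reverse e) i := snk.
have cG0t := consistent_tr cG0.
have uG0t : 1%:M - G0^T \in unitmx by rewrite unit_tr.
split.
- move=> G cG uG T.
  have uGt : 1%:M - G^T \in unitmx by rewrite unit_tr.
  have [Gi Tii Tij] := source_structure src (consistent_tr cG) uGt.
  rewrite inv_tr in Tii Tij.
  split=> [j||j ji]; first by have := Gi j; rewrite mxE.
    by move: Tii; rewrite mxE.
  by have := Tij j ji; rewrite mxE.
- have nzG0t a b : reverse e a b -> G0^T b a != 0.
    by rewrite trE; exact: nzG0.
  move=> C E iC /network_identifiable_tr.
  exact: (source_excitation src cG0t uG0t nzG0t iC).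
- move=> C E j k _; have [add rem] := source_measure src cG0t uG0t E C k j.
  by split; (split=> /tf_identifiable_tr idG; apply/tf_identifiable_tr);
    [exact/add | exact/add | exact/rem | exact/rem].
Qed.
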